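(* Let $\mathbb{K}$ be a field, $m\ge 1$, $n=2m-1$, $S=\mathbb{K}[x_1,\ldots,x_n]$, and let $X=X_m^{(1,n)}$ be the $m\times m$ generic Hankel matrix with entries $x_1,\ldots,x_n$. Let $f=\det X\cdot\det X_{m-1}^{(2,n-1)}\in S$. Then $I_t(X)\in\mathcal{C}_f$ for $t=1,\ldots,m$.
   Context: For integers $l\le n$ and $m$, $X_m^{(l,n)}$ denotes the generic Hankel matrix with $m$ rows and $n-m-l+2$ columns whose $(i,j)$ entry is $x_{l+i+j-2}$ (so its entries are $x_l,\ldots,x_n$). For a matrix $M$, $I_t(M)$ is the ideal of $S$ generated by all $t\times t$ minors of $M$. For $f\in S$, $\mathcal{C}_f$ denotes the smallest set of ideals of $S$ such that: (1) $(f)\in\mathcal{C}_f$; (2) if $I\in\mathcal{C}_f$ then $I:J\in\mathcal{C}_f$ for every ideal $J\subseteq S$; (3) if $I,J\in\mathcal{C}_f$ then $I+J\in\mathcal{C}_f$ and $I\cap J\in\mathcal{C}_f$. *)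

(* Defs.v *)
From HB Require Import structures.
From mathcomp Require Import all_boot all_order all_algebra.
From mathcomp Require Import mpoly.
Set Implicit Arguments. Unset Strict Implicit. Unset Printing Implicit Defensive.
Import Order.TTheory GRing.Theory.
Local Open Scope ring_scope.

Section Ideals.
Variable R : comRingType.

Definition is_ideal (I : R -> Prop) : Prop :=
  [/\ I 0, (forall a b, I a -> I b -> I (a + b)) &
      (forall r a, I a -> I (r * a))].

Definition ideal_gen (A : R -> Prop) : R -> Prop :=
  fun x => forall I, is_ideal I -> (forall a, A a -> I a) -> I x.

Definition principal (f : R) : R -> Prop := ideal_gen (fun g => g = f).

Definition ideal_sum (I J : R -> Prop) : R -> Prop :=
  fun x => exists a b, [/\ I a, J b & x = a + b].

Definition ideal_cap (I J : R -> Prop) : R -> Prop :=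
  fun x => I x /\ J x.

Definition ideal_colon (I J : R -> Prop) : R -> Prop :=
  fun x => forall y, J y -> I (x * y).

Inductive inC (f : R) : (R -> Prop) -> Prop :=
  | inC_gen : inC f (principal f)
  | inC_colon : forall I J, inC f I -> is_ideal J -> inC f (ideal_colon I J)
  | inC_sum : forall I J, inC f I -> inC f J -> inC f (ideal_sum I J)
  | inC_cap : forall I J, inC f I -> inC f J -> inC f (ideal_cap I J).

Definition minor_ideal (t r c : nat) (M : 'M[R]_(r, c)) : R -> Prop :=
  ideal_gen (fun g => exists (rs : 'I_t -> 'I_r) (cs : 'I_t -> 'I_c),
    [/\ (forall i j : 'I_t, (i < j)%N -> (rs i < rs j)%N),
        (forall i j : 'I_t, (i < j)%N -> (cs i < cs j)%N) &
        g = \det (mxsub rs cs M)]).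
End Ideals.

(* x_k (1-based, 1 <= k <= n); returns 0 outside range (never used there). *)
Definition xvar (K : fieldType) (n k : nat) : {mpoly K[n]} :=
  if k is k'.+1 then
    (if (insub k' : option 'I_n) is Some i then 'X_i else 0)
  else 0.

(* hankel K n r c l : r x c matrix whose (i,j) entry (1-based) is
   x_{l+i+j-2}; with 0-based i j this is x_{l+i+j}.
   X_m^{(l,n)} = hankel K n m (n-m-l+2) l. *)
Definition hankel (K : fieldType) (n r c l : nat) : 'M[{mpoly K[n]}]_(r, c) :=
  \matrix_(i < r, j < c) xvar K n (l + i + j).

(* Main.v *)
(* The polynomials vanishing on all sums of [r] geometric progressions form a prime ideal
   [P]. Weight the variable [x_k] by a convex function
   of [k]: the minor on rows [floor (a_i / 2)] and columns [ceil (a_j / 2)] has leading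
   monomial [prod x_(a_i)] whenever the sequence [a] has gaps at least 2, and a
   degeneration of the parametrisation shows that every leading monomial of [P] is
   divisible by such a product with [r + 1] factors. Hence [P] is the ideal of
   [(r + 1)]-minors, and sums and intersections of these ideals can be compared on
   supports of monomials. Writing [I_t(l, h)] for the ideal of [t]-minors in the variables
   [x_l .. x_h], one gets for [t < m], [n = 2 m - 1]
     [I_(t+1)(1, n) + I_t(2, n-1) = I_t(1, n-1) cap I_t(2, n)] (this uses that [n] is odd),
     [I_t(1, n-1) + I_t(2, n) = I_t(1, n) cap I_(t-1)(2, n-1)].
   By primality each ideal on the right is a colon of the left-hand side by the other
   one, so one descends from [I_m(1, n) = (det X)] and [I_(m-1)(2, n-1)], which are colons
   of [(f)]. *)
Require Import Defs.
From Stdlib Require Import FunctionalExtensionality PropExtensionality.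
From mathcomp Require Import all_boot all_order all_fingroup all_algebra.
From mathcomp Require Import mpoly.
From mathcomp Require Import zify ring.
Set Implicit Arguments. Unset Strict Implicit. Unset Printing Implicit Defensive.
Import Order.TTheory GRing.Theory.
Local Open Scope nat_scope.

(** * Gapped index sequences and the splicing of two of them *)

Definition gapped (lo hi t : nat) (f : nat -> nat) : Prop :=
  (forall i, i.+1 < t -> (f i).+2 <= f i.+1) /\
  (forall i, i < t -> lo <= f i < hi).

(** [S] will be the support of a monomial; the property then says that the diagonal term of some
    [t]-minor in the window [[lo, hi)] divides this monomial. *)
Definition has_gapped (S : pred nat) (lo hi t : nat) : Prop :=
  exists f, gapped lo hi t f /\ forall i, i < t -> S (f i).

Lemma gapped_le lo hi t f i j :
  gapped lo hi t f -> i <= j -> j < t -> f i + 2 * (j - i) <= f j.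
Proof.
move=> [gf _]; elim: j => [|j IHj] lij ljt; first by (have -> : i = 0 by lia); lia.
have [->|nij] := eqVneq i j.+1; first by lia.
have := IHj ltac:(lia) ltac:(lia); have := gf j ljt; lia.
Qed.

Lemma gapped_lt lo hi t f i j :
  gapped lo hi t f -> i < j -> j < t -> (f i).+2 <= f j.
Proof. by move=> gf lij ljt; have := gapped_le gf (ltnW lij) ljt; lia. Qed.

Lemma gappedW lo hi lo' hi' t f :
  gapped lo hi t f -> lo' <= lo -> hi <= hi' -> gapped lo' hi' t f.
Proof. by move=> [g1 g2] l h; split=> // i /g2; lia. Qed.

Lemma gapped_splice lo hi s t f g i j :
  gapped lo hi s f -> gapped lo hi t g -> i < s -> j < t ->
  (f i).+2 <= g j ->
  gapped lo hi (i.+1 + (t - j)) (fun k => if k <= i then f k else g (k - i.+1 + j)).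
Proof.
move=> gf gg lis ljt hij; split=> k hk /=.
  case: (leqP k.+1 i) => h1; case: (leqP k i) => h2; try lia.
  - by apply: (proj1 gf); lia.
  - have ki : k = i by lia.
    by rewrite ki (_ : _ + j = j) //; lia.
  - have -> : k.+1 - i.+1 + j = (k - i.+1 + j).+1 by lia.
    by apply: (proj1 gg); lia.
by case: (leqP k i) => h; [apply: (proj2 gf) | apply: (proj2 gg)]; lia.
Qed.

Lemma has_gapped_splice (S : pred nat) lo hi s t f g i j :
  gapped lo hi s f -> gapped lo hi t g ->
  (forall i, i < s -> S (f i)) -> (forall i, i < t -> S (g i)) ->
  i < s -> j < t -> (f i).+2 <= g j -> has_gapped S lo hi (i.+1 + (t - j)).
Proof.
move=> gf gg Sf Sg lis ljt hij; eexists; split.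
  exact: gapped_splice gf gg lis ljt hij.
by move=> k hk /=; case: (leqP k i) => h; [apply: Sf | apply: Sg]; lia.
Qed.

Lemma gapped_take lo hi s t f : gapped lo hi t f -> s <= t -> gapped lo hi s f.
Proof. by move=> [g1 g2] lst; split=> i hi'; [apply: g1|apply: g2]; lia. Qed.

Lemma gapped_drop lo hi lo' t f s : gapped lo hi t f -> (s < t -> lo' <= f s) ->
  gapped lo' hi (t - s) (fun i => f (i + s)).
Proof.
move=> gf hs; split=> i hi'; first by apply: (proj1 gf); lia.
have := gapped_le gf (leq_addl i s) ltac:(lia).
have := (proj2 gf) (i + s) ltac:(lia); have := hs ltac:(lia); lia.
Qed.

Lemma gapped_shrink_hi lo hi hi' t f : gapped lo hi t f ->
  (0 < t -> f t.-1 < hi') -> gapped lo hi' t f.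
Proof.
move=> gf hs; split=> i hi''; first exact: (proj1 gf).
have := gapped_le gf (_ : i <= t.-1) ltac:(lia).
have := (proj2 gf) i hi''; have := hs ltac:(lia); lia.
Qed.

Lemma gapped_shrink_lo lo hi lo' t f : gapped lo hi t f ->
  (0 < t -> lo' <= f 0) -> gapped lo' hi t f.
Proof.
move=> gf hs; split=> i hi''; first exact: (proj1 gf).
have := gapped_le gf (leq0n i) hi''.
have := (proj2 gf) i hi''; have := hs ltac:(lia); lia.
Qed.

(** Unless one sequence already avoids both ends, [a] starts at [0] and [b] ends at [n - 1]. A
    switch from [a] to [b] gains an entry; a switch from [b] to [a] avoids both ends. If neither is
    possible, then [a i = 2 i] and [b] ends at the odd number [2 t - 1], while [n - 1] is even. *)
Lemma has_gapped_ends S n t : odd n -> 0 < t ->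
  has_gapped S 0 n.-1 t -> has_gapped S 1 n t ->
  has_gapped S 0 n t.+1 \/ has_gapped S 1 n.-1 t.
Proof.
move=> on t0 [a [ga Sa]] [b [gb Sb]].
have [a0|a0] := posnP (a 0); last first.
  by right; exists a; split=> //; apply: gapped_shrink_lo ga _.
have [bt|bt] := ltnP (b t.-1) n.-1.
  by right; exists b; split=> //; apply: gapped_shrink_hi gb _.
have ga' : gapped 0 n t a by apply: gappedW ga _ _; lia.
have gb' : gapped 0 n t b by apply: gappedW gb _ _; lia.
case: (boolP [exists i : 'I_t, (a i).+2 <= b i]) => [/existsP[i hi]|].
  left; have := has_gapped_splice ga' gb' Sa Sb (ltn_ord i) (ltn_ord i) hi.
  by have -> : i.+1 + (t - i) = t.+1 by have := ltn_ord i; lia.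
rewrite negb_exists => /forallP hab.
have ab i : i < t -> b i <= (a i).+1.
  by move=> it; have := hab (Ordinal it); rewrite -ltnNge ltnS.
case: (boolP [exists i : 'I_t, (i.+1 < t) && ((b i).+2 <= a i.+1)])
    => [/existsP[i /andP[it hi]]|].
  right.
  have gb1 : gapped 1 n.-1 i.+1 b.
    apply: gapped_shrink_hi (gapped_take gb (ltn_ord i)) _ => _ /=.
    by have := (proj2 ga) _ it; lia.
  have ga1 : gapped 1 n.-1 (t - i.+1) (fun k => a (k + i.+1)).
    by apply: gapped_drop ga _ => _; lia.
  have := has_gapped_splice (S := S) (i := i) (j := 0) gb1 ga1.
  rewrite add0n subn0 subnKC //; apply=> //; try lia.
  - by move=> k hk; apply: Sb; lia.
  - by move=> k hk; apply: Sa; lia.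
rewrite negb_exists => /forallP hba.
have ba i : i.+1 < t -> a i.+1 <= (b i).+1.
  move=> it; have := hba (Ordinal (ltnW it)); rewrite negb_and /= it /=.
  by rewrite -ltnNge ltnS.
have ai i : i < t -> a i = 2 * i.
  elim: i => [|i IHi] it; first by rewrite a0.
  have := IHi (ltnW it); have := ba i it; have := ab i (ltnW it).
  by have := (proj1 ga) i it; lia.
have bi : b t.-1 = (2 * t).-1.
  have := ab t.-1 ltac:(lia); rewrite (ai t.-1) ?ltn_predL //.
  have := gapped_le gb (leq0n t.-1) ltac:(lia).
  by have := (proj2 gb) 0 t0; lia.
have := (proj2 gb) t.-1 ltac:(lia); lia.
Qed.

(** The same two switches are tried. If neither is possible, then [a t = 2 t], which is less than
    [n - 1], although [a] reaches [n - 1] in the remaining case. *)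
Lemma has_gapped_middle S n t : t.*2.+1 < n ->
  has_gapped S 0 n t.+1 -> has_gapped S 1 n.-1 t ->
  has_gapped S 0 n.-1 t.+1 \/ has_gapped S 1 n t.+1.
Proof.
move=> tn [a [ga Sa]] [b [gb Sb]].
have [a0|a0] := posnP (a 0); last first.
  by right; exists a; split=> //; apply: gapped_shrink_lo ga _.
have [bt|bt] := ltnP (a t) n.-1.
  by left; exists a; split=> //; apply: gapped_shrink_hi ga _.
case: (boolP [exists i : 'I_t, (a i).+2 <= b i]) => [/existsP[i hi]|].
  left.
  have ga1 : gapped 0 n.-1 i.+1 a.
    apply: gapped_shrink_hi (gapped_take ga _) _ => [|_ /=]; first by have := ltn_ord i; lia.
    by have := (proj2 gb) _ (ltn_ord i); lia.
  have gb1 : gapped 0 n.-1 t b by apply: gappedW gb _ _.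
  have := has_gapped_splice (S := S) ga1 gb1 _ Sb (ltnSn i) (ltn_ord i) hi.
  have -> : i.+1 + (t - i) = t.+1 by have := ltn_ord i; lia.
  by apply=> k hk; apply: Sa; have := ltn_ord i; lia.
rewrite negb_exists => /forallP hab.
have ab i : i < t -> b i <= (a i).+1.
  by move=> it; have := hab (Ordinal it); rewrite -ltnNge ltnS.
case: (boolP [exists i : 'I_t, (b i).+2 <= a i.+1]) => [/existsP[i hi]|].
  right.
  have gb1 : gapped 1 n t b by apply: gappedW gb _ _; lia.
  have ga1 : gapped 1 n (t.+1 - i.+1) (fun k => a (k + i.+1)).
    by apply: gapped_drop ga _ => _; lia.
  have := has_gapped_splice (S := S) (i := i) (j := 0) gb1 ga1 Sb.
  have it := ltn_ord i.
  rewrite add0n subn0 subnKC ?ltnS; last by lia.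
  by apply=> //; try lia; move=> k hk; apply: Sa; lia.
rewrite negb_exists => /forallP hba.
have ba i : i < t -> a i.+1 <= (b i).+1.
  by move=> it; have := hba (Ordinal it); rewrite -ltnNge ltnS.
have ai i : i <= t -> a i = 2 * i.
  elim: i => [|i IHi] it; first by rewrite a0.
  have := IHi (ltnW it); have := ba i it; have := ab i it.
  by have := (proj1 ga) i it; lia.
have := ai t (leqnn t); lia.
Qed.

(** Greedy choice from below. It yields an alternative for supports of monomials: either they
    contain a long gapped sequence, or few pairs of neighbours cover them. *)
Lemma pair_cover (S : pred nat) lo hi : exists r f,
  [/\ gapped lo hi r f, (forall i, i < r -> S (f i)) &
      forall k, S k -> lo <= k < hi -> exists2 i, i < r & (k == f i) || (k == (f i).+1)].
Proof.
elim: hi => [|hi [r [f [gf Sf cf]]]].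
  by exists 0, id; split=> // k _; lia.
have gf' : gapped lo hi.+1 r f by apply: gappedW gf _ _.
case: (boolP [&& S hi, lo <= hi & (0 < r) ==> ((f r.-1).+2 <= hi)]) => [/and3P[Sh lh fr]|nh].
  exists r.+1, (fun i => if i < r then f i else hi); split.
  - split=> i hi' /=; last by case: (ltnP i r) => h; [have := (proj2 gf') i h|]; lia.
    case: (ltnP i.+1 r) => h; first by rewrite (ltnW h); apply: (proj1 gf).
    have ri : r = i.+1 by lia.
    by move: fr; rewrite ri /= ltnSn.
  - by move=> i _; case: (ltnP i r) => h //; apply: Sf.
  - move=> k Sk kb; have [->|nk] := eqVneq k hi.
      by exists r; rewrite ?ltnSn // ltnn eqxx.
    have [i ir ki] := cf k Sk ltac:(lia).
    by exists i; [lia|rewrite ir].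
exists r, f; split=> // k Sk kb; have [kh|nk] := eqVneq k hi; last first.
  by apply: cf => //; lia.
move: nh; rewrite -kh Sk /=; have -> /= : lo <= k by lia.
rewrite negb_imply => /andP[r0 hr]; exists r.-1; first by lia.
have := (proj2 gf) r.-1 ltac:(lia); lia.
Qed.

(** * Floors and ceilings of halves under a permutation *)

Lemma half_uphalf_ltn a b : a.+2 <= b -> (a./2 < b./2) && (uphalf a < uphalf b).
Proof. by move=> h; rewrite !uphalf_half; lia. Qed.

(* With [f = floor (a / 2)] and [c = ceil (a / 2)] one has [c - f] in [{0, 1}], while
   [x ^ 2 >= x] for integers [x]; summing over [x = c (s i) - f i] gives the claim. *)
Lemma sum_sqr_half_lt lo hi t a (s : {perm 'I_t}) : gapped lo hi t a -> s != 1%g ->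
  \sum_(i < t) ((a i)./2 + uphalf (a (s i))) ^ 2 < \sum_(i < t) (a i) ^ 2.
Proof.
move=> ga s1.
pose f i := (a i)./2; pose c i := uphalf (a i).
have rsum (F : nat -> nat) : \sum_(i < t) F (s i) = \sum_(i < t) F i.
  by rewrite [RHS](reindex_inj (@perm_inj _ s)).
suff: \sum_(i < t) ((f i + c (s i)) ^ 2 + c (s i)) <
      \sum_(i < t) (2 * (f i) ^ 2 + 2 * (c (s i)) ^ 2 + f i).
  have r1 : \sum_(i < t) c (s i) = \sum_(i < t) c i := rsum c.
  have r2 : \sum_(i < t) 2 * c (s i) ^ 2 = \sum_(i < t) 2 * c i ^ 2.
    exact: (rsum (fun i => 2 * c i ^ 2)).
  rewrite [X in X < _]big_split [X in _ < X]big_split [X in _ < X + _]big_split /= r1 r2.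
  suff -> : \sum_(i < t) 2 * f i ^ 2 + \sum_(i < t) 2 * c i ^ 2 + \sum_(i < t) f i =
            \sum_(i < t) a i ^ 2 + \sum_(i < t) c i by rewrite ltn_add2r.
  rewrite -!big_split /=; apply: eq_bigr => i _; rewrite /f /c uphalf_half.
  move: (odd_double_half (a i)); move: (odd (a i)) ((a i)./2) => b h <-.
  by case: b; nia.
have le_i (x y : nat) : (x + y) ^ 2 + y <= 2 * x ^ 2 + 2 * y ^ 2 + x.
  by case: (leqP y x) => [|/ltnW] /subnKC <-; [|case: (y - x) => [|d]]; nia.
have lt_i (x y : nat) : y < x \/ x.+1 < y ->
    (x + y) ^ 2 + y < 2 * x ^ 2 + 2 * y ^ 2 + x.
  by case=> /subnKC <-; nia.
suff [j hj] : exists j : 'I_t, c (s j) < f j \/ (f j).+1 < c (s j).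
  rewrite (bigD1 j) //= [X in _ < X](bigD1 j) //= -addSn.
  by apply: leq_add; [apply: lt_i | apply: leq_sum].
have [i0 hi0] : exists i, s i != i.
  apply/existsP; apply: contra_neqT s1; rewrite negb_exists => /forallP h.
  by apply/permP => i; rewrite perm1; apply/eqP; rewrite -[_ == _]negbK; apply: h.
(* Let [i] be the least moved index, so that [s i] and its preimage [j] both exceed [i]. If [a i] is
   odd, [c (s i) > c i = f i + 1] gives strictness at [i]; if it is even, [f j > f i = c i] gives it
   at [j]. *)
case: (@arg_minnP _ i0 (fun i => s i != i) val hi0) => i ni imin.
have low (j : 'I_t) : j < i -> s j = j.
  by move=> ji; apply/eqP; apply: contraTT ji => /imin; rewrite -leqNgt.
have si : i < s i.
  rewrite ltn_neqAle eq_sym val_eqE ni /= leqNgt; apply/negP => /low /perm_inj h.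
  by move: ni; rewrite h eqxx.
pose j := (s^-1)%g i; have sj : s j = i by rewrite permKV.
have ij : i < j.
  rewrite ltn_neqAle leqNgt; apply/andP; split.
    by apply: contra ni => /eqP/val_inj eij; rewrite {1}eij sj.
  by apply/negP => /low h; move: si; rewrite -sj h h ltnn.
have /andP[h1 _] := half_uphalf_ltn (gapped_lt ga ij (ltn_ord j)).
have /andP[_ h2] := half_uphalf_ltn (gapped_lt ga si (ltn_ord (s i))).
case: (boolP (odd (a i))) => oi; [exists i; right|exists j; left; rewrite sj];
  move: h1 h2 oi; rewrite /c /f !uphalf_half; lia.
Qed.
Local Open Scope ring_scope.

(** * Weights of monomials and top terms of Hankel minors *)

Section Weights.
Variables (K : fieldType) (n : nat).
Implicit Types (m : 'X_{1..n}) (p : {mpoly K[n]}).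

(** The form is dictated by the degeneration in [secant_ideal_top]: the factor [4] allows completing
    the square with an odd [q = 2 f + 1], and the constant keeps the exponents
    [(2 n + 1) ^ 2 + 1 - q ^ 2] from truncating. *)
Definition weight (k : nat) : nat := ((2 * n).+1 ^ 2 + 4 * k ^ 2)%N.
Definition mweight m : nat := (\sum_(i < n) m i * weight i)%N.
Definition mvar (k : nat) : 'X_{1..n} :=
  if insub k is Some i then U_(i)%MM else 0%MM.
Definition mvars t (a : 'I_t -> nat) : 'X_{1..n} := (\sum_(i < t) mvar (a i))%MM.

Lemma mweightD m1 m2 : mweight (m1 + m2)%MM = (mweight m1 + mweight m2)%N.
Proof.
by rewrite /mweight -big_split; apply: eq_bigr => i _; rewrite mnmDE mulnDl.
Qed.

Lemma mweight0 : mweight 0%MM = 0%N.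
Proof. by apply: big1 => i _; rewrite mnm0E. Qed.

Lemma mvar_ord (i : 'I_n) : mvar i = U_(i)%MM.
Proof. by rewrite /mvar valK. Qed.

Lemma mweight_mvar k : (k < n)%N -> mweight (mvar k) = weight k.
Proof.
move=> kn; rewrite -[k]/(val (Ordinal kn)) mvar_ord /mweight.
rewrite (bigD1 (Ordinal kn)) //= mnm1E eqxx mul1n big1 ?addn0 // => i ni.
by rewrite mnm1E eq_sym (negbTE ni).
Qed.

Lemma mweight_mvars t (a : 'I_t -> nat) : (forall i, (a i < n)%N) ->
  mweight (mvars a) = (\sum_(i < t) weight (a i))%N.
Proof.
move=> an; rewrite /mvars (big_morph _ mweightD mweight0).
by apply: eq_bigr => i _; rewrite mweight_mvar.
Qed.

Lemma xvar_ord (i : 'I_n) : xvar K n i.+1 = 'X_i.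
Proof. by rewrite /= valK. Qed.

Lemma xvarE k : (k < n)%N -> xvar K n k.+1 = 'X_[mvar k].
Proof. by move=> kn; rewrite (xvar_ord (Ordinal kn)) -mvar_ord. Qed.

Lemma prod_xvar t (a : 'I_t -> nat) : (forall i, (a i < n)%N) ->
  \prod_(i < t) xvar K n (a i).+1 = 'X_[mvars a].
Proof.
move=> an; rewrite /mvars (big_morph _ (@mpolyXD n K) (@mpolyX0 n K)).
by apply: eq_bigr => i _; rewrite xvarE.
Qed.

Lemma mvars_gt0 t (a : 'I_t -> nat) (k : 'I_n) :
  (0 < mvars a k)%N -> exists i, a i = k.
Proof.
rewrite /mvars mnm_sumE lt0n sum_nat_eq0 negb_forall => /existsP[i /=].
rewrite /mvar; case: insubP => [j _ ji|_]; last by rewrite mnm0E.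
by rewrite mnm1E; case: (j =P k) => // <- _; exists i.
Qed.

(* From here on variables are numbered from 0: number [k] is [xvar K n k.+1]. *)
Definition hankel_minor t (a : nat -> nat) : {mpoly K[n]} :=
  \det (\matrix_(i < t, j < t) xvar K n ((a i)./2 + uphalf (a j)).+1).

Lemma half_uphalf_bound lo hi t a i j : gapped lo hi t a ->
  (i < t)%N -> (j < t)%N -> (lo <= (a i)./2 + uphalf (a j) < hi)%N.
Proof.
move=> ga it jt; have := proj2 ga i it; have := proj2 ga j jt.
rewrite uphalf_half; lia.
Qed.

(** The identity permutation gives the diagonal monomial. All terms have degree [t], so the constant
    parts of their weights agree, and [sum_sqr_half_lt] puts every other permutation strictly
    below. *)
Lemma hankel_minor_top lo hi t a : gapped lo hi t a -> (hi <= n)%N ->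
  forall m, m \in msupp (hankel_minor t a - 'X_[mvars (fun i : 'I_t => a i)]) ->
  (mweight m < mweight (mvars (fun i : 'I_t => a i)))%N.
Proof.
move=> ga hn m; set W := mweight (mvars _).
pose low p := forall m, m \in msupp p -> (mweight m < W)%N.
have low0 : low 0 by move=> m'; rewrite msupp0.
have lowD p q : low p -> low q -> low (p + q).
  by move=> lp lq m' /msuppD_le; rewrite mem_cat => /orP[/lp|/lq].
suff: low (hankel_minor t a - 'X_[mvars (fun i : 'I_t => a i)]) by apply.
rewrite /hankel_minor /determinant (bigD1 1%g) //= odd_perm1 expr0 mul1r.
have bnd i j : ((a (i : 'I_t))./2 + uphalf (a (j : 'I_t)) < n)%N.
  by have := half_uphalf_bound ga (ltn_ord i) (ltn_ord j); lia.
have -> : 'X_[mvars (fun i : 'I_t => a i)] =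
    \prod_(i < t) (\matrix_(i < t, j < t) xvar K n ((a i)./2 + uphalf (a j)).+1) i ((1%g : {perm 'I_t}) i).
  rewrite -prod_xvar => [|i]; last by have := proj2 ga i (ltn_ord i); lia.
  apply: eq_bigr => i _; rewrite mxE perm1; congr (xvar _ _ _.+1).
  by rewrite uphalf_half; lia.
rewrite addrAC subrr add0r; apply: (big_ind low) => // s s1 m'.
have -> : \prod_(i < t) (\matrix_(i < t, j < t)
    xvar K n ((a i)./2 + uphalf (a j)).+1) i (s i) =
    'X_[mvars (fun i => (a i)./2 + uphalf (a (s i)))%N].
  by rewrite -prod_xvar //; apply: eq_bigr => i _; rewrite mxE.
rewrite mulr_sign => hm; have {hm} : m' \in msupp ('X_[mvars (fun i => (a i)./2 + uphalf (a (s i)))%N] : {mpoly K[n]}).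
  by case: (odd_perm s) hm => //; rewrite (perm_mem (msuppN _)).
rewrite msuppX inE => /eqP->; rewrite /W !mweight_mvars //; last first.
  by move=> i; have := proj2 ga i (ltn_ord i); lia.
have wE (F : 'I_t -> nat) : (\sum_(i < t) weight (F i) =
    \sum_(i < t) (2 * n).+1 ^ 2 + 4 * \sum_(i < t) F i ^ 2)%N.
  by rewrite big_distrr -big_split.
rewrite !wE ltn_add2l ltn_pmul2l //.
exact: sum_sqr_half_lt ga s1.
Qed.

Lemma hankel_minor_mcoeff lo hi t a : gapped lo hi t a -> (hi <= n)%N ->
  (hankel_minor t a)@_(mvars (fun i : 'I_t => a i)) = 1.
Proof.
move=> ga hn; set m := mvars _; apply/eqP; rewrite -subr_eq0.
have -> : 1 = ('X_[m] : {mpoly K[n]})@_m by rewrite mcoeffX eqxx.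
rewrite -mcoeffB mcoeff_eq0; apply/negP => /(hankel_minor_top ga hn).
by rewrite ltnn.
Qed.

Lemma hankel_minor_le lo hi t a m : gapped lo hi t a -> (hi <= n)%N ->
  m \in msupp (hankel_minor t a) ->
  (mweight m <= mweight (mvars (fun i : 'I_t => a i)))%N.
Proof.
move=> ga hn; rewrite -[hankel_minor t a](subrK 'X_[mvars (fun i : 'I_t => a i)]).
move=> /msuppD_le; rewrite mem_cat => /orP[/(hankel_minor_top ga hn)/ltnW //|].
by rewrite msuppX inE => /eqP->.
Qed.

End Weights.

(** * The prime ideal of sums of geometric progressions *)

(** Padding [l] with zero pairs writes [M] as a product of two square matrices, the first of which
    has a zero column at index [size l]. *)
Lemma det_low_rank (R : comNzRingType) t (l : seq (('I_t -> R) * ('I_t -> R)))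
    (M : 'M[R]_t) :
  (forall i j, M i j = \sum_(q <- l) q.1 i * q.2 j) -> (size l < t)%N -> \det M = 0.
Proof.
move=> hM lt; pose q0 : ('I_t -> R) * ('I_t -> R) := (fun=> 0, fun=> 0).
have -> : M = (\matrix_(i < t, k < t) (nth q0 l k).1 i) *m (\matrix_(k < t, j < t) (nth q0 l k).2 j).
  apply/matrixP => i j; rewrite hM !mxE (big_nth q0) big_mkord.
  rewrite (big_ord_widen t (fun k => (nth q0 l k).1 i * (nth q0 l k).2 j)) 1?ltnW //.
  rewrite big_mkcond /=; apply: eq_bigr => k _; rewrite !mxE; case: ltnP => // h.
  by rewrite nth_default // mul0r.
rewrite det_mulmx (expand_det_col _ (Ordinal lt)) big1 ?mul0r // => i _.
by rewrite mxE nth_default // mul0r.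
Qed.

Section Secant.
Variables (K : fieldType) (n : nat).

(** Coordinates outside the window are left free, so each window yields an ideal of the same ring in
    all [n] variables. *)
Definition secant_point (E : comNzRingType) r lo hi (c s : 'I_r -> E) (y : 'I_n -> E)
    (k : 'I_n) : E :=
  if (lo <= k < hi)%N then \sum_(a < r) c a * s a ^+ k else y k.

Definition generic_secant_point r lo hi : 'I_n -> {mpoly K[r + r + n]} :=
  secant_point lo hi (fun a => 'X_(lshift n (lshift r a)))
    (fun a => 'X_(lshift n (rshift r a))) (fun k => 'X_(rshift (r + r) k)).

(** Vanishing is asked at the generic point only. This is the kernel of a ring map into a domain,
    hence prime over every field, finite ones included. *)
Definition secant_ideal r lo hi (p : {mpoly K[n]}) : Prop :=
  mmap (@mpolyC _ K) (generic_secant_point r lo hi) p = 0.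

Lemma secant_ideal_ideal r lo hi : is_ideal (secant_ideal r lo hi).
Proof.
split; rewrite /secant_ideal; first exact: rmorph0.
  by move=> p q hp hq; rewrite rmorphD /= hp hq addr0.
by move=> p q hq; rewrite rmorphM /= hq mulr0.
Qed.

Lemma secant_ideal_prime r lo hi p q :
  secant_ideal r lo hi (p * q) -> secant_ideal r lo hi p \/ secant_ideal r lo hi q.
Proof.
rewrite /secant_ideal rmorphM /= => /eqP; rewrite mulf_eq0.
by case/orP => /eqP ->; [left|right].
Qed.

(** The substitution [v] specialises the generic point to the given one. *)
Lemma secant_ideal_vanish r lo hi p (E : comNzRingType) (h : {rmorphism K -> E}) c s y :
  secant_ideal r lo hi p -> mmap h (@secant_point E r lo hi c s y) p = 0.
Proof.
pose v (i : 'I_(r + r + n)) : E :=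
  match split i with
  | inl j => match split j with inl a => c a | inr a => s a end
  | inr k => y k
  end.
have vy k : v (rshift (r + r) k) = y k by rewrite /v (unsplitK (inr k)).
have vc a : v (lshift n (lshift r a)) = c a.
  by rewrite /v (unsplitK (inl (lshift r a))) (unsplitK (inl a)).
have vs a : v (lshift n (rshift r a)) = s a.
  by rewrite /v (unsplitK (inl (rshift r a))) (unsplitK (inr a)).
rewrite /secant_ideal => /(congr1 (mmap h v)); rewrite rmorph0 => hp.
rewrite -{}hp [X in _ = mmap h v X]/mmap raddf_sum /=.
apply: eq_bigr => m _.
rewrite rmorphM /= mmapC; congr (_ * _); rewrite /mmap1 rmorph_prod /=.
apply: eq_bigr => k _; rewrite rmorphXn /=; congr (_ ^+ _).
rewrite /generic_secant_point /secant_point; case: ifP => _; last first.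
  by rewrite mmapX mmap1U vy.
rewrite rmorph_sum /=; apply: eq_bigr => a _.
by rewrite rmorphM rmorphXn /= !mmapX !mmap1U vc vs.
Qed.

(** At the generic point the window entries form a sum of [r] rank-one matrices. The flags [b] and
    [e] permit one foreign variable in the first and in the last corner; each costs one further
    rank-one matrix, so the rank stays below [t]. *)
Lemma secant_ideal_minor r lo hi (b e : bool) t (ro co : 'I_t -> nat) :
  (r + b + e < t)%N ->
  (forall i j, (ro i + co j < n)%N) ->
  (forall i j, (ro i + co j < lo)%N -> [/\ b, i = 0 :> nat & j = 0 :> nat]) ->
  (forall i j, (hi <= ro i + co j)%N -> [/\ e, i.+1 = t & j.+1 = t]) ->
  secant_ideal r lo hi (\det (\matrix_(i < t, j < t) xvar K n (ro i + co j).+1)).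
Proof.
move=> rt rcn hlo hhi; rewrite /secant_ideal.
pose phi := mmap (@mpolyC (r + r + n) K) (generic_secant_point r lo hi).
rewrite -/phi; set M := (X in \det X).
have -> : phi (\det M) = \det (map_mx phi M) by exact: esym (det_map_mx _ _).
pose c a : {mpoly K[r + r + n]} := 'X_(lshift n (lshift r a)).
pose s a : {mpoly K[r + r + n]} := 'X_(lshift n (rshift r a)).
(* [d] measures how far coordinate [k] is from the sum of progressions; it vanishes inside the
   window. [d1] keeps the defect below the window, [d2] the one above. *)
pose d k := phi (xvar K n k.+1) - \sum_(a < r) c a * s a ^+ k.
have dE k : (k < n)%N -> (lo <= k < hi)%N -> d k = 0.
  move=> kn kb; rewrite /d (xvar_ord _ (Ordinal kn)) /phi mmapX mmap1U.
  by rewrite /generic_secant_point /secant_point /= kb subrr.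
pose d1 k := if (k < lo)%N then d k else 0.
pose d2 k := if (k < lo)%N then 0 else d k.
pose l := [seq (fun i : 'I_t => c a * s a ^+ ro i, fun j : 'I_t => s a ^+ co j)
             | a <- enum 'I_r]
   ++ nseq b (fun i : 'I_t => (i == 0%N :> nat)%:R * d1 (ro i + co i)%N,
              fun j : 'I_t => (j == 0%N :> nat)%:R)
   ++ nseq e (fun i : 'I_t => (i.+1 == t)%:R * d2 (ro i + co i)%N,
              fun j : 'I_t => (j.+1 == t)%:R).
apply: (@det_low_rank _ t l); last first.
  by rewrite !size_cat size_map size_enum_ord !size_nseq addnA.
move=> i j; rewrite !mxE !big_cat /= big_map big_enum /=.
have -> : phi (xvar K n (ro i + co j).+1) =
    \sum_(a < r) c a * s a ^+ (ro i + co j) + (d1 (ro i + co j)%N + d2 (ro i + co j)%N).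
  by rewrite /d1 /d2; case: ifP => _; rewrite ?addr0 ?add0r /d addrC subrK.
congr (_ + (_ + _)).
- by apply: eq_bigr => a _; rewrite exprD mulrA.
- case: (b) hlo => hlo; last first.
    by rewrite big_nil /d1; case: ifP => // /hlo[].
  rewrite /= big_seq1 /=.
  case: (eqVneq (val i) 0%N) => i0; case: (eqVneq (val j) 0%N) => j0;
    rewrite ?mul0r ?mulr0 ?mul1r ?mulr1.
  + by have -> : i = j by apply: val_inj; rewrite i0.
  + by rewrite /d1; case: ifP => // /hlo[_ _ h]; move: j0; rewrite /= h.
  + by rewrite /d1; case: ifP => // /hlo[_ h _]; move: i0; rewrite /= h.
  + by rewrite /d1; case: ifP => // /hlo[_ _ h]; move: j0; rewrite /= h.
- have d2E : ~ [/\ e, i.+1 = t & j.+1 = t] -> d2 (ro i + co j)%N = 0.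
    move=> nij; rewrite /d2; case: ltnP => // h1; apply: dE => //.
    by rewrite h1 ltnNge; apply/negP => /hhi.
  case: (e) hhi d2E => hhi d2E; last by rewrite big_nil d2E // => -[].
  rewrite /= big_seq1 /=.
  have [/andP[/eqP it /eqP jt]|nij] := boolP ((i.+1 == t) && (j.+1 == t)).
    have <- : i = j by apply: val_inj; apply: succn_inj; rewrite it.
    by rewrite it eqxx mul1r mulr1.
  rewrite d2E; last by case=> _ it jt; move: nij; rewrite it jt eqxx.
  by case: (i.+1 == t) nij => [/=/negbTE->|_]; rewrite ?mul0r ?mulr0.
Qed.

(** By the gaps, only [a 0] can lie below the window and only the last value above it, so foreign
    variables occur at most in the two opposite corners. *)
Lemma gapped_minor_secant_ideal r lo hi (b e : bool) t a :
  gapped (lo - b) (hi + e) t a -> (hi + e <= n)%N -> (r + b + e < t)%N ->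
  secant_ideal r lo hi (hankel_minor K n t a).
Proof.
move=> ga hn rt.
apply: (@secant_ideal_minor _ _ _ b e t (fun i => (a i)./2) (fun j => uphalf (a j))) => //.
- by move=> i j; have := half_uphalf_bound ga (ltn_ord i) (ltn_ord j); lia.
- move=> i j h; have := gapped_le ga (leq0n i) (ltn_ord i).
  have := gapped_le ga (leq0n j) (ltn_ord j); have := proj2 ga 0%N ltac:(lia).
  by move: h; rewrite uphalf_half; case: (b) => /=; split; lia.
- move=> i j h; pose l := t.-1; have lt : (l < t)%N by rewrite /l; lia.
  have al : ((a l) < hi + e)%N by have := proj2 ga l lt; lia.
  have last (k : 'I_t) : k.+1 <> t -> ((a k).+2 <= a l)%N.
    by move=> kt; apply: gapped_lt ga _ lt; have := ltn_ord k; rewrite /l; lia.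
  have lel (k : 'I_t) : (a k <= a l)%N.
    by have := gapped_le ga (_ : k <= l)%N lt; rewrite /l; have := ltn_ord k; lia.
  have := lel i; have := lel j; have := last i; have := last j; move: h.
  rewrite uphalf_half => h lj li le_j le_i.
  have it : i.+1 = t by case: (eqVneq i.+1 t) => // /eqP /li; case: (e) al; lia.
  have jt : j.+1 = t by case: (eqVneq j.+1 t) => // /eqP /lj; case: (e) al; lia.
  by split=> //; case: (e) al => //; lia.
Qed.

End Secant.

(** * Top coefficients of univariate polynomials *)

Section LeadingCoefficient.
Variable R : comNzRingType.
Implicit Types (p q : {poly R}) (d : nat).

(** [d] merely bounds the degree and [z] may be [0]; this makes the notion compatible with all sums
    at fixed [d] and with all products. *)
Definition top_coef p d (z : R) : Prop := p`_d = z /\ forall j, (d < j)%N -> p`_j = 0.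

Lemma top_coefM p q d e y z :
  top_coef p d y -> top_coef q e z -> top_coef (p * q) (d + e) (y * z).
Proof.
move=> [py p0] [qz q0].
have dlt : (d < (d + e).+1)%N by rewrite ltnS leq_addr.
split=> [|j hj]; rewrite coefM.
  rewrite (bigD1 (Ordinal dlt)) //= py addKn qz big1 ?addr0 // => i.
  rewrite -val_eqE /=; case: ltngtP => // h _; last by rewrite p0 ?mul0r.
  by rewrite (q0 (d + e - i)%N) ?mulr0 //; lia.
rewrite big1 // => i _; have [h|h] := ltnP d i; first by rewrite p0 ?mul0r.
by rewrite (q0 (j - i)%N) ?mulr0 //; lia.
Qed.

Lemma top_coefC c : top_coef c%:P 0 c.
Proof. by split=> [|j]; rewrite coefC // lt0n => /negbTE->. Qed.

Lemma top_coefX p d z k : top_coef p d z -> top_coef (p ^+ k) (k * d) (z ^+ k).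
Proof.
move=> hp; elim: k => [|k IHk]; first by rewrite !expr0; exact: top_coefC.
by rewrite !exprS mulSn; exact: top_coefM.
Qed.

Lemma top_coef_prod (I : Type) (l : seq I) (F : I -> {poly R}) (D : I -> nat) (Z : I -> R) :
  (forall i, top_coef (F i) (D i) (Z i)) ->
  top_coef (\prod_(i <- l) F i) (\sum_(i <- l) D i) (\prod_(i <- l) Z i).
Proof.
move=> h; elim: l => [|i l IHl]; first by rewrite !big_nil; exact: top_coefC.
by rewrite !big_cons; exact: top_coefM.
Qed.

Lemma top_coefZXn c e d : (e <= d)%N ->
  top_coef (c *: 'X^e) d (if e == d then c else 0).
Proof.
move=> le; split=> [|j hj]; rewrite coefZ coefXn.
  by rewrite eq_sym; case: eqP; rewrite ?mulr1 ?mulr0.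
by rewrite (_ : j == e = false) ?mulr0 //; apply/negbTE; lia.
Qed.

Lemma top_coef_sum (I : Type) (l : seq I) (F : I -> {poly R}) d (Z : I -> R) :
  (forall i, top_coef (F i) d (Z i)) ->
  top_coef (\sum_(i <- l) F i) d (\sum_(i <- l) Z i).
Proof.
move=> h; split=> [|j hj]; rewrite coef_sum.
  by apply: eq_bigr => i _; case: (h i).
by rewrite big1 // => i _; have [_ ->] := h i.
Qed.

End LeadingCoefficient.

(** * Leading monomials of the prime ideal, by degeneration *)

Section SecantTop.
Variables (K : fieldType) (n : nat).

Definition msupport (m : 'X_{1..n}) : pred nat :=
  fun k => [exists i : 'I_n, (i == k :> nat) && (0 < m i)%N].

Lemma msupport_ord (m : 'X_{1..n}) (i : 'I_n) : msupport m i = (0 < m i)%N.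
Proof.
apply/existsP/idP => [[j /andP[/eqP/val_inj <-]]|hi] //.
by exists i; rewrite eqxx.
Qed.

(** Both claims concern the odd square [(2 k - (2 f + 1)) ^ 2]: it is at least [1], with equality
    exactly at the two integers around [f + 1/2]. *)
Lemma pair_parabola (f k : nat) :
  (4 * (2 * f).+1 * k < 4 * k ^ 2 + (2 * f).+1 ^ 2)%N /\
  (4 * (2 * f).+1 * k).+1 == (4 * k ^ 2 + (2 * f).+1 ^ 2)%N = (k == f) || (k == f.+1).
Proof.
case: (leqP f k) => [|/ltnW] /subnKC <-.
  by case: (k - f)%N => [|[|d]]; split; try nia; apply/eqP/orP; nia.
by case: (f - k)%N => [|d]; split; try nia; apply/eqP/orP; nia.
Qed.

(** Amplitude and ratio of the geometric progression that takes the values [A] at [f] and [B] at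
    [f + 1]. *)
Lemma secant_coef (L : fieldType) (A B : L) (f : nat) : A != 0 -> B != 0 ->
  A ^+ f.+1 / B ^+ f * (B / A) ^+ f = A /\
  A ^+ f.+1 / B ^+ f * (B / A) ^+ f.+1 = B.
Proof.
move=> A0 B0; rewrite !expr_div_n !mulf_div; split;
  apply: (canLR (mulfK _)); rewrite ?mulf_neq0 ?expf_neq0 //; rewrite !exprS; ring.
Qed.

(* Specialise [c_a] and [s_a] to [u_a T ^ e_a] and [v_a T ^ (4 (2 k_a + 1))], so that
   the [T]-degree of the [k]-th coordinate is [weight k - ((2 (k - k_a) - 1) ^ 2 - 1)]: the
   top term survives exactly for [k = k_a] and [k = k_a + 1], where [u_a] and [v_a] are
   chosen to make its coefficient the variable [X_k]. *)
Lemma secant_ideal_top r lo hi (p : {mpoly K[n]}) (m0 : 'X_{1..n}) :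
  (hi <= n)%N ->
  secant_ideal r lo hi p -> m0 \in msupp p ->
  (forall m, m \in msupp p -> (mweight m <= mweight m0)%N) ->
  has_gapped (msupport m0) lo hi r.+1.
Proof.
move=> hn Pp m0p m0max.
have [r' [f [gf Sf cf]]] := pair_cover (msupport m0) lo hi.
have [r'r|rr'] := leqP r' r; last first.
  by exists f; split=> [|i it]; [exact: gapped_take gf rr' | apply: Sf; lia].
(* Now [r' <= r] pairs cover the support of [m0] within the window, so one progression can be spent
   on each pair. *)
exfalso.
pose L : fieldType := {fraction {mpoly K[n]}}.
pose fr : {mpoly K[n]} -> L := @tofrac _.
(* [(f a).+1] may equal [n], where there is no variable; the default [1] keeps [Z] invertible. *)
pose Z k : L := if insub k is Some i then fr 'X_(i : 'I_n) else 1.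
have Z0 k : Z k != 0.
  rewrite /Z; case: insubP => [i _ _|_]; last exact: oner_neq0.
  rewrite /fr tofrac_eq0; apply/eqP => /(congr1 (mcoeff U_(i))).
  by rewrite mcoeffX eqxx mcoeff0 => /eqP; rewrite oner_eq0.
have ZE (i : 'I_n) : Z i = fr 'X_i by rewrite /Z valK.
pose near a k := (k == f a) || (k == (f a).+1).
pose q a := (2 * f a).+1.
pose c (a : 'I_r) : {poly L} := if (a < r')%N then
  (Z (f a) ^+ (f a).+1 / Z (f a).+1 ^+ f a) *: 'X^(((2 * n).+1 ^ 2).+1 - q a ^ 2) else 0.
pose s (a : 'I_r) : {poly L} := (Z (f a).+1 / Z (f a)) *: 'X^(4 * q a).
pose y (k : 'I_n) : {poly L} := Z k *: 'X^(weight n k).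
pose F k := ~~ (lo <= k < hi)%N || [exists a : 'I_r, (a < r')%N && near a k].
pose z (k : 'I_n) : {mpoly K[n]} := if F k then 'X_k else 0.
pose h : K -> {poly L} := polyC \o fr \o (@mpolyC n K).
have point_top (k : 'I_n) :
    top_coef (secant_point lo hi c s y k) (weight n k) (fr (z k)).
  rewrite /secant_point /z /F; case: ifP => kb /=; last first.
    by rewrite -ZE; have := top_coefZXn (Z k) (leqnn (weight n k)); rewrite eqxx.
  have term_top (a : 'I_r) : top_coef (c a * s a ^+ k) (weight n k)
      (if (a < r')%N && near a k then Z k else 0).
    rewrite /c; case: ltnP => ar' /=; last first.
      by rewrite mul0r; split=> [|j _]; rewrite coef0.
    rewrite /s exprZn -exprM -scalerAl -scalerAr scalerA -exprD.
    set e := (_ + _)%N.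
    have fn : (f a < n)%N by have := proj2 gf a ar'; lia.
    have eE : (e + q a ^ 2 = ((2 * n).+1 ^ 2).+1 + 4 * q a * k)%N.
      rewrite /e addnAC subnK // ltnW // ltnS leq_exp2r // /q; lia.
    have [lew ew] : (e <= weight n k)%N /\ (e == weight n k) = near a k.
      have [le1 le2] := pair_parabola (f a) k; move: eE le1 le2.
      by rewrite /weight /near -/(q a); lia.
    have := top_coefZXn (Z (f a) ^+ (f a).+1 / Z (f a).+1 ^+ f a * (Z (f a).+1 / Z (f a)) ^+ k) lew.
    rewrite ew; congr top_coef; rewrite /near; case: eqP => [->|_] /=.
      exact: (proj1 (secant_coef _ (Z0 _) (Z0 _))).
    by case: eqP => // ->; exact: (proj2 (secant_coef _ (Z0 _) (Z0 _))).
  have -> : fr (if [exists a : 'I_r, (a < r')%N && near a k] then 'X_k else 0) =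
      \sum_(a < r) if (a < r')%N && near a k then Z k else 0.
    case: existsP => [[a ha]|na]; last first.
      rewrite big1 /fr ?tofrac0 // => a _; case: ifP => // ha.
      by case: na; exists a.
    (* Pairs from a gapped sequence are disjoint, so a single progression contributes at [k]. *)
    rewrite (bigD1 a) //= ha ZE big1 ?addr0 // => b nba; case: ifP => // hb.
    case/andP: ha => ar' ha; case/andP: hb => br' hb.
    have : (a < b)%N || (b < a)%N by rewrite -neq_ltn eq_sym.
    by move: ha hb; rewrite /near => ha hb /orP[] hab;
      have := gapped_lt gf hab ltac:(done); lia.
  exact: top_coef_sum.
have h0 := @secant_ideal_vanish K n r lo hi p _ h c s y Pp.
have topm m : top_coef (h p@_m * mmap1 (secant_point lo hi c s y) m) (mweight m)
    (fr ((p@_m)%:MP * \prod_(i < n) z i ^+ m i)).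
  have -> : fr ((p@_m)%:MP * \prod_(i < n) z i ^+ m i) =
      fr (p@_m)%:MP * \prod_(i < n) fr (z i) ^+ m i.
    rewrite /fr tofracM rmorph_prod; congr (_ * _).
    by apply: eq_bigr => i _; rewrite rmorphXn.
  rewrite -[mweight m]add0n; apply: top_coefM; first exact: top_coefC.
  by apply: top_coef_prod => i; apply: top_coefX.
have zprod (m : 'X_{1..n}) : \prod_(i < n) z i ^+ m i =
    if [forall i : 'I_n, (0 < m i)%N ==> F i] then 'X_[m] else 0.
  case: forallP => [hF|/forallP].
    rewrite mpolyXE_id; apply: eq_bigr => i _; rewrite /z.
    by have := hF i; case: (posnP (m i)) => [->|_ /= ->]; rewrite ?expr0.
  rewrite negb_forall => /existsP[i]; rewrite negb_imply => /andP[mi nF].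
  by rewrite (bigD1 i) //= /z (negbTE nF) expr0n (gtn_eqF mi) mul0r.
(* [g] is the top-weight part of [p] with the uncovered variables set to [0]. It is the coefficient
   of [T ^ mweight m0] in a polynomial that vanishes, yet [m0] survives in it. *)
pose g := \sum_(m <- msupp p) if mweight m == mweight m0 then
  (p@_m)%:MP * \prod_(i < n) z i ^+ m i else 0.
have g0 : g = 0.
  apply/eqP; rewrite -(tofrac_eq0 g) -[X in _ == X](coef0 _ (mweight m0)) -h0 /mmap coef_sum.
  rewrite /g rmorph_sum /=; apply/eqP; apply: eq_big_seq => m mp.
  have [te tl] := topm m; case: eqP => [<-|/eqP ne]; first by rewrite te.
  by rewrite tofrac0 tl // ltn_neqAle ne m0max.
have : g@_m0 = p@_m0.
  rewrite /g raddf_sum /= (bigD1_seq m0) ?msupp_uniq //= eqxx zprod.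
  have -> : [forall i : 'I_n, (0 < m0 i)%N ==> F i].
    apply/forallP => i; apply/implyP => mi; rewrite /F.
    have [ib|//] := boolP (lo <= i < hi)%N; have [|a ar' ha] := cf i _ ib.
      by rewrite msupport_ord.
    by apply/existsP; exists (Ordinal (leq_trans ar' r'r)); rewrite /= ar'.
  rewrite mcoeffCM mcoeffX eqxx mulr1 big1 ?addr0 // => m nm.
  case: ifP => _; last by rewrite mcoeff0.
  rewrite zprod mcoeffCM; case: ifP => _; last by rewrite mcoeff0 mulr0.
  by rewrite mcoeffX (negbTE nm) mulr0.
move/eqP; rewrite g0 mcoeff0 eq_sym; apply/negP.
by rewrite -mcoeff_msupp.
Qed.

End SecantTop.

(** * Generalities on ideals given as predicates *)

Section Ideals.
Variable R : comNzRingType.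
Implicit Types (A B I J : R -> Prop).

(** [inC] speaks of predicates up to equality, so ideals with the same elements must be made equal;
    this rests on functional and propositional extensionality. *)
Lemma ideal_ext I J : (forall x, I x <-> J x) -> I = J.
Proof.
by move=> IJ; apply: functional_extensionality => x; apply: propositional_extensionality.
Qed.

Lemma ideal_gen_ideal A : is_ideal (ideal_gen A).
Proof.
split=> [I [I0 _ _] _ //|a b ga gb I iI hA|r a ga I iI hA].
  by case: (iI) => _ hD _; apply: hD; [apply: ga | apply: gb].
by case: (iI) => _ _ hM; apply: hM; apply: ga.
Qed.

Lemma mem_ideal_gen A x : A x -> ideal_gen A x.
Proof. by move=> Ax I _; apply. Qed.

Lemma idealB I x y : is_ideal I -> I x -> I y -> I (x - y).
Proof. by case=> _ hD hM Ix Iy; apply: hD => //; rewrite -mulN1r; apply: hM. Qed.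

Lemma ideal_mulr I x y : is_ideal I -> I x -> I (x * y).
Proof. by case=> _ _ hM Ix; rewrite mulrC; apply: hM. Qed.

Lemma ideal_sum_ideal I J : is_ideal I -> is_ideal J -> is_ideal (ideal_sum I J).
Proof.
move=> [I0 ID IM] [J0 JD JM]; split.
- by exists 0, 0; rewrite addr0.
- move=> _ _ [a [b [Ia Jb ->]]] [c [d [Ic Jd ->]]].
  by exists (a + c), (b + d); split; [exact: ID | exact: JD | rewrite addrACA].
- move=> r _ [a [b [Ia Jb ->]]]; exists (r * a), (r * b).
  by split; [exact: IM | exact: JM | rewrite mulrDr].
Qed.

Lemma ideal_suml I J x : is_ideal J -> I x -> ideal_sum I J x.
Proof. by move=> [J0 _ _] Ix; exists x, 0; rewrite addr0. Qed.

Lemma ideal_sumr I J x : is_ideal I -> J x -> ideal_sum I J x.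
Proof. by move=> [I0 _ _] Jx; exists 0, x; rewrite add0r. Qed.

Lemma principalE (f x : R) : principal f x <-> exists r, x = r * f.
Proof.
split=> [h|[r ->] I [_ _ hM] hf]; last by apply: hM; apply: hf.
apply: (h (fun y => exists r, y = r * f)); last by move=> _ ->; exists 1; rewrite mul1r.
split; first by exists 0; rewrite mul0r.
  by move=> _ _ [r ->] [s ->]; exists (r + s); rewrite mulrDl.
by move=> r _ [s ->]; exists (r * s); rewrite mulrA.
Qed.

(** [(A cap B) : B = A : B], and the last hypothesis, which holds for a prime [A] not containing
    [B], reduces this to [A]. *)
Lemma ideal_colon_cap S A B : is_ideal A -> is_ideal B ->
  (forall x, S x <-> A x /\ B x) ->
  (forall x, (forall y, B y -> A (x * y)) -> A x) -> ideal_colon S B = A.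
Proof.
move=> iA iB hS hA; apply: ideal_ext => x; split=> [hx|Ax y By].
  by apply: hA => y /hx /hS[].
by apply/hS; split; [exact: ideal_mulr | case: iB => _ _; apply].
Qed.

End Ideals.

(** * Ideals of Hankel minors: primality, sums and intersections *)

Section HankelIdeals.
Variables (K : fieldType) (n : nat).
Implicit Types (p : {mpoly K[n]}) (I J : {mpoly K[n]} -> Prop).

(** The weight is no monomial order: several monomials of [p] may share the top weight, and each of
    them counts as leading. *)
Definition leading_mono p (m : 'X_{1..n}) : Prop :=
  m \in msupp p /\ forall m', m' \in msupp p -> (mweight m' <= mweight m)%N.

Definition lower p (w : nat) : Prop := forall m, m \in msupp p -> (mweight m < w)%N.

Lemma lowerD p q w : lower p w -> lower q w -> lower (p + q) w.
Proof. by move=> lp lq m /msuppD_le; rewrite mem_cat => /orP[/lp|/lq]. Qed.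

Lemma lowerZ c p w : lower p w -> lower (c *: p) w.
Proof. by move=> lp m /msuppZ_le /lp. Qed.

(* Division by leading terms, all monomials of the top weight being cancelled at once. *)
Lemma sub_ideal_of_leading I J : is_ideal I -> is_ideal J -> (forall p, I p -> J p) ->
  (forall p m, J p -> leading_mono p m ->
     exists2 g, I g & lower (g - 'X_[m]) (mweight m)) ->
  forall p, J p -> I p.
Proof.
move=> iI iJ IJ lead p Jp.
have [w pw] : exists w, lower p w.
  exists (\sum_(m <- msupp p) mweight m).+1 => m mp.
  by rewrite ltnS (bigD1_seq m) ?msupp_uniq //= leq_addr.
elim: w p Jp pw => [|w IHw] p Jp pw.
  suff -> : p = 0 by case: iI.
  apply: msuppnil0; case E: (msupp p) => [//|m s].
  by have := pw m; rewrite E mem_head => /(_ isT).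
suff [q Iq pq] : exists2 q, I q & lower (p - q) w.
  rewrite -[p](subrK q); have [_ ID _] := iI; apply: ID => //.
  by apply: IHw => //; apply: idealB => //; apply: IJ.
rewrite [p]mpolyE.
have: {subset msupp p <= msupp p} by [].
elim: {1 3}(msupp p) => [|m s IHs] sp.
  by exists 0; [case: iI | rewrite big_nil subr0 => m; rewrite msupp0].
have [q Iq lq] := IHs (fun x xs => sp x (mem_behead (s := m :: s) xs)).
have mp : m \in msupp p by apply: sp; rewrite mem_head.
have := pw m mp; rewrite ltnS leq_eqVlt => /orP[/eqP wm|wm]; last first.
  exists q => //; rewrite big_cons -addrA; apply: lowerD => //; apply: lowerZ => m'.
  by rewrite msuppX inE => /eqP->.
have [|g Ig lg] := lead p m Jp.
  by split=> // m' /pw; rewrite wm ltnS.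
exists (q + p@_m *: g).
  by case: iI => _ ID IM; apply: ID => //; rewrite -mul_mpolyC; apply: IM.
rewrite big_cons opprD [- q + _]addrC addrACA -scalerBr; apply: lowerD => //.
apply: lowerZ; rewrite -opprB => m'; rewrite (perm_mem (msuppN _)) -wm; exact: lg.
Qed.

(** One generator per gapped sequence suffices, and no matrix shape has to be chosen for a
    window. *)
Definition hankel_ideal t lo hi : {mpoly K[n]} -> Prop :=
  ideal_gen (fun g => exists a, gapped lo hi t a /\ g = hankel_minor K n t a).

Lemma hankel_ideal_ideal t lo hi : is_ideal (hankel_ideal t lo hi).
Proof. exact: ideal_gen_ideal. Qed.
Hint Resolve hankel_ideal_ideal : core.

Lemma mem_hankel_ideal t lo hi a :
  gapped lo hi t a -> hankel_ideal t lo hi (hankel_minor K n t a).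
Proof. by move=> ga; apply: mem_ideal_gen; exists a. Qed.

Lemma hankel_ideal_sub t lo hi I : is_ideal I ->
  (forall a, gapped lo hi t a -> I (hankel_minor K n t a)) ->
  forall p, hankel_ideal t lo hi p -> I p.
Proof. by move=> iI h p; apply=> // _ [a [/h Ia ->]]. Qed.

(** The empty minor is [1]. This case closes the descent, whose inner ideal ends at size [0]. *)
Lemma hankel_ideal0 lo hi p : hankel_ideal 0 lo hi p.
Proof.
rewrite -[p]mulr1; case: (hankel_ideal_ideal 0 lo hi) => _ _; apply.
rewrite -(det_mx00 (\matrix_(i < 0, j < 0) xvar K n ((id i)./2 + uphalf (id j)).+1)).
by apply: (mem_hankel_ideal (a := id)); split.
Qed.

Lemma mvars_le lo hi t a (m : 'X_{1..n}) : gapped lo hi t a -> (hi <= n)%N ->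
  (forall i, (i < t)%N -> msupport m (a i)) -> (mvars n (fun i : 'I_t => a i) <= m)%MM.
Proof.
move=> ga hn am; apply/mnm_lepP => k.
case: (posnP (mvars n (fun i : 'I_t => a i) k)) => [->//|/mvars_gt0[i ik]].
have := am i (ltn_ord i); rewrite ik msupport_ord; apply: leq_trans.
rewrite /mvars mnm_sumE (bigD1 i) //= big1 => [|j ji].
  by rewrite ik mvar_ord mnm1E eqxx.
have ajn : (a j < n)%N by have := proj2 ga j (ltn_ord j); lia.
rewrite (mvar_ord (Ordinal ajn)) mnm1E -val_eqE /= -ik; apply/eqP; rewrite eqb0.
have : (j < i)%N || (i < j)%N by rewrite -neq_ltn.
by case/orP => h; have := gapped_lt ga h (ltn_ord _); lia.
Qed.

Lemma hankel_ideal_lead t lo hi (m : 'X_{1..n}) : (hi <= n)%N ->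
  has_gapped (msupport m) lo hi t ->
  exists2 g, hankel_ideal t lo hi g & lower (g - 'X_[m]) (mweight m).
Proof.
move=> hn [a [ga am]]; set v := mvars n (fun i : 'I_t => a i).
have vm : (m - v + v)%MM = m by rewrite submK //; exact: mvars_le ga hn am.
exists (hankel_minor K n t a * 'X_[m - v]).
  exact: (ideal_mulr _ (hankel_ideal_ideal t lo hi) (mem_hankel_ideal ga)).
rewrite -{2 3}vm mpolyXD [X in _ - X]mulrC -mulrBl => m'.
rewrite (perm_mem (msuppMX _ _)) => /mapP[m1 /(hankel_minor_top ga hn) lt ->].
by rewrite !mweightD ltn_add2l.
Qed.

(** The rank bound gives one inclusion. For the other, [secant_ideal_top] shows that each leading
    monomial of the prime ideal is the top term of a multiple of a minor. *)
Lemma hankel_ideal_secant r lo hi p : (hi <= n)%N ->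
  hankel_ideal r.+1 lo hi p <-> secant_ideal r lo hi p.
Proof.
move=> hn.
have IJ q : hankel_ideal r.+1 lo hi q -> secant_ideal r lo hi q.
  apply: (hankel_ideal_sub (secant_ideal_ideal _ _ _ _ _)) => a ga.
  by apply: (@gapped_minor_secant_ideal _ _ _ _ _ false false); rewrite ?subn0 ?addn0.
split=> [/IJ//|]; apply: sub_ideal_of_leading => //.
  exact: secant_ideal_ideal.
move=> q m hq [mq mmax]; apply: hankel_ideal_lead => //.
exact: secant_ideal_top hq mq mmax.
Qed.

Lemma hankel_ideal_top t lo hi p m : (hi <= n)%N -> hankel_ideal t lo hi p ->
  leading_mono p m -> has_gapped (msupport m) lo hi t.
Proof.
case: t => [|t] hn; first by exists id; split=> //; split.
by move=> /hankel_ideal_secant -/(_ hn) hp [mp mmax]; exact: secant_ideal_top hp mp mmax.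
Qed.

(** Widening the window by one variable at an end is paid for by one more row and column. *)
Lemma mem_hankel_ideal_ends t lo hi (b e : bool) s a : (hi + e <= n)%N ->
  (t + b + e <= s)%N -> gapped (lo - b) (hi + e) s a ->
  hankel_ideal t lo hi (hankel_minor K n s a).
Proof.
case: t => [|t] hn ts ga; first exact: hankel_ideal0.
apply/hankel_ideal_secant; first by lia.
exact: gapped_minor_secant_ideal ga hn ts.
Qed.

(** Otherwise the diagonal monomial of the minor would be a leading monomial of the ideal, and its
    support would contain a gapped sequence excluded by the hypothesis. *)
Lemma not_mem_hankel_ideal t lo hi s lo' hi' a : (hi <= n)%N -> (hi' <= n)%N ->
  gapped lo' hi' s a ->
  (forall f, gapped lo hi t f ->
     (forall i, (i < t)%N -> exists2 j, (j < s)%N & a j = f i) -> False) ->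
  ~ hankel_ideal t lo hi (hankel_minor K n s a).
Proof.
move=> hn hn' ga nf /hankel_ideal_top -/(_ (mvars n (fun i : 'I_s => a i)) hn) [].
  split=> [|m' /(hankel_minor_le ga hn')//].
  by rewrite mcoeff_msupp (hankel_minor_mcoeff _ ga hn') oner_neq0.
move=> f [gf fa]; apply: (nf f gf) => i it.
have fin : (f i < n)%N by have := proj2 gf i it; lia.
have := fa i it; rewrite (msupport_ord _ (Ordinal fin)) => /mvars_gt0[j aj].
by exists j.
Qed.

Lemma hankel_ideal_colon t lo hi J : (hi <= n)%N ->
  ((0 < t)%N -> exists2 b, J b & ~ hankel_ideal t lo hi b) ->
  forall x, (forall y, J y -> hankel_ideal t lo hi (x * y)) -> hankel_ideal t lo hi x.
Proof.
case: t => [|t] hn hJ x hx; first exact: hankel_ideal0.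
have [//|b Jb nb] := hJ; have := hx b Jb => /hankel_ideal_secant -/(_ hn).
case/secant_ideal_prime => /hankel_ideal_secant -/(_ hn) // /nb[].
Qed.

Lemma hankel_ideal_principal t lo hi d x :
  (exists a, gapped lo hi t a) ->
  (forall a, gapped lo hi t a -> hankel_minor K n t a = d) ->
  hankel_ideal t lo hi x <-> exists r, x = r * d.
Proof.
move=> [a ga] hd; rewrite -principalE; split.
  by apply: (hankel_ideal_sub (ideal_gen_ideal _)) => b /hd ->; exact: mem_ideal_gen.
by apply=> // _ ->; rewrite -(hd a ga); exact: mem_hankel_ideal.
Qed.

Lemma hankel_minor_neq0 lo hi t a : gapped lo hi t a -> (hi <= n)%N ->
  hankel_minor K n t a != 0.
Proof.
move=> ga hn; apply/eqP => h; have /eqP := hankel_minor_mcoeff K ga hn.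
by rewrite h mcoeff0 eq_sym oner_eq0.
Qed.

(** The sum lies in the intersection by the rank bound. Conversely, a leading monomial of an element
    of the intersection satisfies both gap conditions, and [has_gapped_ends] makes it a leading
    monomial of one summand. *)
Lemma hankel_ideal_sum_ends t x : odd n -> (0 < t)%N ->
  ideal_sum (hankel_ideal t.+1 0 n) (hankel_ideal t 1 n.-1) x <->
  hankel_ideal t 0 n.-1 x /\ hankel_ideal t 1 n x.
Proof.
move=> on t0; have n0 : (0 < n)%N by case: (n) on.
have n1 : (n.-1 <= n)%N by rewrite leq_pred.
pose C := ideal_cap (hankel_ideal t 0 n.-1) (hankel_ideal t 1 n).
have iC : is_ideal C.
  have [A0 AD AM] := hankel_ideal_ideal t 0 n.-1; have [B0 BD BM] := hankel_ideal_ideal t 1 n.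
  by split=> // [a b [? ?] [? ?]|r a [? ?]]; split; auto.
have iS := ideal_sum_ideal (hankel_ideal_ideal t.+1 0 n) (hankel_ideal_ideal t 1 n.-1).
have sub y : ideal_sum (hankel_ideal t.+1 0 n) (hankel_ideal t 1 n.-1) y -> C y.
  move=> [a [b [ha hb ->]]]; have [_ CD _] := iC; apply: CD; [move: a ha|move: b hb];
    apply: hankel_ideal_sub => // f gf; split.
  - apply: (@mem_hankel_ideal_ends _ _ _ false true); rewrite ?subn0 ?addn0 ?addn1 ?prednK //.
  - apply: (@mem_hankel_ideal_ends _ _ _ true false); rewrite ?subn0 ?addn0 ?addn1 ?subnn //.
  - by apply: mem_hankel_ideal; apply: gappedW gf _ _.
  - by apply: mem_hankel_ideal; apply: gappedW gf _ _.
split=> [/sub//|Cx]; apply: (sub_ideal_of_leading iS iC sub _ Cx).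
move=> p m [pA pB] pm.
have [h|h] := has_gapped_ends on t0 (hankel_ideal_top n1 pA pm) (hankel_ideal_top (leqnn n) pB pm).
  have [g hg lg] := hankel_ideal_lead (leqnn n) h; exists g => //; exact: ideal_suml.
have [g hg lg] := hankel_ideal_lead n1 h; exists g => //; exact: ideal_sumr.
Qed.

Lemma hankel_ideal_sum_middle t x : (t.*2.+1 < n)%N ->
  ideal_sum (hankel_ideal t.+1 0 n.-1) (hankel_ideal t.+1 1 n) x <->
  hankel_ideal t.+1 0 n x /\ hankel_ideal t 1 n.-1 x.
Proof.
move=> tn; have n0 : (0 < n)%N by lia.
have n1 : (n.-1 <= n)%N by rewrite leq_pred.
pose C := ideal_cap (hankel_ideal t.+1 0 n) (hankel_ideal t 1 n.-1).
have iC : is_ideal C.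
  have [A0 AD AM] := hankel_ideal_ideal t.+1 0 n; have [B0 BD BM] := hankel_ideal_ideal t 1 n.-1.
  by split=> // [a b [? ?] [? ?]|r a [? ?]]; split; auto.
have iS := ideal_sum_ideal (hankel_ideal_ideal t.+1 0 n.-1) (hankel_ideal_ideal t.+1 1 n).
have sub y : ideal_sum (hankel_ideal t.+1 0 n.-1) (hankel_ideal t.+1 1 n) y -> C y.
  move=> [a [b [ha hb ->]]]; have [_ CD _] := iC; apply: CD; [move: a ha|move: b hb];
    apply: hankel_ideal_sub => // f gf; split.
  - by apply: mem_hankel_ideal; apply: gappedW gf _ _.
  - apply: (@mem_hankel_ideal_ends _ _ _ true false); rewrite ?subn0 ?addn0 ?addn1 ?subnn //.
  - by apply: mem_hankel_ideal; apply: gappedW gf _ _.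
  - apply: (@mem_hankel_ideal_ends _ _ _ false true); rewrite ?subn0 ?addn0 ?addn1 ?prednK //.
split=> [/sub//|Cx]; apply: (sub_ideal_of_leading iS iC sub _ Cx).
move=> p m [pA pB] pm.
have [h|h] := has_gapped_middle tn (hankel_ideal_top (leqnn n) pA pm) (hankel_ideal_top n1 pB pm).
  have [g hg lg] := hankel_ideal_lead n1 h; exists g => //; exact: ideal_suml.
have [g hg lg] := hankel_ideal_lead (leqnn n) h; exists g => //; exact: ideal_sumr.
Qed.

End HankelIdeals.
#[local] Hint Resolve hankel_ideal_ideal : core.

(** * One round of the descent *)

Section HankelKnutson.
Variables (K : fieldType) (n : nat) (f : {mpoly K[n]}).
Local Notation I t lo hi := (@hankel_ideal K n t lo hi).

Lemma inC_hankel_ideal_step t : odd n -> (t.*2.+2 < n)%N ->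
  inC f (I t.+2 0 n) -> inC f (I t.+1 1 n.-1) ->
  inC f (I t.+1 0 n) /\ inC f (I t 1 n.-1).
Proof.
move=> on tn hX hY.
have n1 : (n.-1 <= n)%N by rewrite leq_pred.
(* Index sequences whose minors separate the ideals: [g1] needs the last variable, [g2] the first,
   [g3] has only [t] values, and for [0 < t] the sequence [g4] keeps only [t - 1] values once both
   ends are removed. *)
have g1 : gapped 1 n t.+1 (fun i => n.-1 - t.*2 + i.*2)%N by split=> i hi; lia.
have g2 : gapped 0 n.-1 t.+1 double by split=> i hi; lia.
have g3 : gapped 1 n.-1 t (fun i => i.*2.+1) by split=> i hi; lia.
have g4 : gapped 0 n t.+1 (fun i => if i < t then i.*2 else n.-1)%N.
  split=> i hi /=; last by case: (ltnP i t); lia.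
  by case: (ltnP i.+1 t); case: (ltnP i t); lia.
have hS := inC_sum hX hY.
have S1 x := hankel_ideal_sum_ends (K := K) x on (ltn0Sn t).
have hA : inC f (I t.+1 0 n.-1).
  rewrite -(ideal_colon_cap (B := I t.+1 1 n) _ _ S1) //; first exact: inC_colon.
  apply: hankel_ideal_colon => // _; eexists; first exact: mem_hankel_ideal g1.
  apply: (not_mem_hankel_ideal n1 (leqnn n) g1) => a ga h.
  have [j jt jE] := h 0%N ltac:(lia); have := gapped_le ga (leq0n t) (ltnSn t).
  by have := proj2 ga t (ltnSn t); lia.
have hB : inC f (I t.+1 1 n).
  rewrite -(@ideal_colon_cap _ (ideal_sum (I t.+2 0 n) (I t.+1 1 n.-1))
    (I t.+1 1 n) (I t.+1 0 n.-1)) //; first exact: inC_colon.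
    by move=> x; rewrite S1; split=> -[].
  apply: hankel_ideal_colon => // _; eexists; first exact: mem_hankel_ideal g2.
  apply: (not_mem_hankel_ideal (leqnn n) n1 g2) => a ga h.
  have [j jt jE] := h 0%N ltac:(lia); have [k kt kE] := h t ltac:(lia).
  by have := gapped_le ga (leq0n t) (ltnSn t); have := proj2 ga 0%N isT; lia.
have {}hS := inC_sum hA hB.
have S2 x := hankel_ideal_sum_middle (K := K) x (ltnW tn : (t.*2.+1 < n)%N).
split.
  rewrite -(ideal_colon_cap (B := I t 1 n.-1) _ _ S2) //; first exact: inC_colon.
  apply: hankel_ideal_colon => // _; eexists; first exact: mem_hankel_ideal g3.
  apply: (not_mem_hankel_ideal (leqnn n) n1 g3) => a ga h.
  have [j jt jE] := h 0%N ltac:(lia); have [k kt kE] := h t ltac:(lia).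
  by have := gapped_le ga (leq0n t) (ltnSn t); lia.
rewrite -(@ideal_colon_cap _ (ideal_sum (I t.+1 0 n.-1) (I t.+1 1 n))
    (I t 1 n.-1) (I t.+1 0 n)) //; first exact: inC_colon.
  by move=> x; rewrite S2; split=> -[].
apply: hankel_ideal_colon => // t0; eexists; first exact: mem_hankel_ideal g4.
apply: (not_mem_hankel_ideal n1 (leqnn n) g4) => a ga h.
have tp : (t.-1 < t)%N by lia.
have [j jt jE] := h 0%N t0; have [k kt kE] := h t.-1 tp.
have := gapped_le ga (leq0n t.-1) tp; have := proj2 ga 0%N t0; have := proj2 ga t.-1 tp.
by move: jE kE; case: (ltnP j t); case: (ltnP k t); lia.
Qed.

End HankelKnutson.

(** * The starting ideals and the conclusion *)

Lemma colon_principal (R : idomainType) (a b : R) x : b != 0 ->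
  ideal_colon (principal (a * b)) (principal b) x <-> exists r, x = r * a.
Proof.
move=> b0; split=> [h|[r ->] y /principalE[s ->]].
  have /principalE[r /eqP] := h b ltac:(exact: mem_ideal_gen).
  by rewrite mulrA (inj_eq (mulIf b0)) => /eqP ->; exists r.
by apply/principalE; exists (r * s); rewrite mulrACA.
Qed.

(** A window of [2 t - 1] variables leaves no slack, so there is only one sequence; this makes the
    two starting ideals principal. *)
Lemma gapped_rigid lo t a i : gapped lo (lo + t.*2.-1) t a -> (i < t)%N ->
  a i = (lo + i.*2)%N.
Proof.
move=> ga it; have := gapped_le ga (leq0n i) it; have tp : (t.-1 < t)%N by lia.
have := gapped_le ga (_ : i <= t.-1)%N tp; have := proj2 ga t.-1 tp.
have := proj2 ga 0%N ltac:(lia); lia.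
Qed.

(** Arbitrary minors lie in the prime ideal by rank. Conversely, floors and ceilings of the halves
    of a gapped sequence are strictly increasing and below [m], so they select rows and columns of
    the square matrix. *)
Lemma minor_ideal_hankel (K : fieldType) (m t : nat) : (0 < t <= m)%N ->
  minor_ideal t (hankel K (2 * m).-1 m m 1) = @hankel_ideal K (2 * m).-1 t 0 (2 * m).-1.
Proof.
case: t => // t tm; apply: ideal_ext => p; split.
  apply=> // _ [rs [cs [_ _ ->]]]; apply/hankel_ideal_secant => //.
  have -> : mxsub rs cs (hankel K (2 * m).-1 m m 1) =
      \matrix_(i, j) xvar K (2 * m).-1 (rs i + cs j).+1.
    by apply/matrixP => i j; rewrite !mxE.
  apply: (@secant_ideal_minor _ _ _ _ _ false false) => [|i j|i j|i j]; rewrite ?addn0 //;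
    by have := ltn_ord (rs i); have := ltn_ord (cs j); lia.
apply: hankel_ideal_sub; first exact: ideal_gen_ideal.
move=> a ga; apply: mem_ideal_gen.
have am i : (i < t.+1)%N -> (a i < (2 * m).-1)%N by move=> /(proj2 ga).
have rm (i : 'I_t.+1) : ((a i)./2 < m)%N by have := am i (ltn_ord i); lia.
have cm (i : 'I_t.+1) : (uphalf (a i) < m)%N.
  by have := am i (ltn_ord i); rewrite uphalf_half; lia.
exists (fun i => Ordinal (rm i)), (fun i => Ordinal (cm i)); split=> [i j|i j|] /=.
- by move=> ij; have /half_uphalf_ltn/andP[] := gapped_lt ga ij (ltn_ord j).
- by move=> ij; have /half_uphalf_ltn/andP[] := gapped_lt ga ij (ltn_ord j).
- by congr (\det _); apply/matrixP => i j; rewrite !mxE.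
Qed.

(* n = 2m-1; X = X_m^{(1,n)} = hankel K n m m 1 (it has n-m-1+2 = m columns);
   X_{m-1}^{(2,n-1)} = hankel K n (m-1) (m-1) 2 (n-1-(m-1)-2+2 = m-1 columns). *)
Theorem theorem3p2 (K : fieldType) (m : nat) (hm : (1 <= m)%N)
  (t : nat) (ht1 : (1 <= t)%N) (htm : (t <= m)%N) :
  let n := (2 * m).-1 in
  let X := hankel K n m m 1 in
  let f := \det X * \det (hankel K n m.-1 m.-1 2) in
  inC f (minor_ideal t X).
Proof.
move=> n X f; set X' := hankel K n m.-1 m.-1 2 in f *.
have gX : gapped 0 n m double by split=> i hi; rewrite /n; lia.
have gX' : gapped 1 n.-1 m.-1 (fun i => i.*2.+1) by split=> i hi; rewrite /n; lia.
have nE : n = (0 + m.*2.-1)%N by rewrite /n; lia.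
(* For [m = 1] the inner matrix is empty and truncation breaks the width formula, hence the second
   case. *)
have n'E : n.-1 = (1 + m.-1.*2.-1)%N \/ m.-1 = 0%N by rewrite /n; lia.
have minorX a : gapped 0 n m a -> hankel_minor K n m a = \det X.
  rewrite {1}nE => ga; congr (\det _); apply/matrixP => i j; rewrite !mxE.
  by rewrite !(gapped_rigid ga) // uphalf_half odd_double !doubleK.
have minorX' a : gapped 1 n.-1 m.-1 a -> hankel_minor K n m.-1 a = \det X'.
  move=> ga; congr (\det _); apply/matrixP => i j; rewrite !mxE.
  case: n'E => [n'E|m0]; last by have := ltn_ord i; rewrite {2}m0.
  rewrite n'E in ga; rewrite !(gapped_rigid ga) // uphalf_half.
  by congr (xvar _ _ _); lia.
have nzX : \det X != 0 by rewrite -(minorX _ gX); exact: hankel_minor_neq0 gX _.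
have nzX' : \det X' != 0.
  by rewrite -(minorX' _ gX'); apply: hankel_minor_neq0 gX' _; exact: leq_pred.
have baseX : inC f (@hankel_ideal K n m 0 n).
  rewrite (_ : hankel_ideal _ _ _ = ideal_colon (principal f) (principal (\det X'))).
    by apply: inC_colon; [exact: inC_gen | exact: ideal_gen_ideal].
  apply: ideal_ext => x; rewrite colon_principal //.
  by apply: hankel_ideal_principal; first exists double.
have baseX' : inC f (@hankel_ideal K n m.-1 1 n.-1).
  rewrite (_ : hankel_ideal _ _ _ = ideal_colon (principal f) (principal (\det X))).
    by apply: inC_colon; [exact: inC_gen | exact: ideal_gen_ideal].
  apply: ideal_ext => x; rewrite /f mulrC colon_principal //.
  by apply: hankel_ideal_principal; first by eexists; exact: gX'.
rewrite minor_ideal_hankel ?ht1 //.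
(* Descent on the size [m - k], carrying the outer and the inner ideal together since each round
   consumes both. *)
suff h k : (k < m)%N ->
    inC f (@hankel_ideal K n (m - k) 0 n) /\ inC f (@hankel_ideal K n (m - k).-1 1 n.-1).
  by have [] := h (m - t)%N ltac:(lia); rewrite subKn.
elim: k => [|k IHk] km; first by rewrite subn0.
have [] := IHk (ltnW km).
have -> : (m - k = (m - k.+2).+2)%N by lia.
have -> : (m - k.+1 = (m - k.+2).+1)%N by lia.
by move=> hX hY; apply: inC_hankel_ideal_step hX hY; rewrite /n; lia.
Qed.
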